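(* Let $Y$ be a positive random variable independent of a random variable $Z$, such that $X=YZ$ has a slowly varying tail. If $EY^\delta<\infty$ for some $\delta>0$, then $Z$ has a slowly varying tail, and $P(Z>x)\sim P(X>x)$ as $x\to\infty$.
   Context: A random variable $W$ has a slowly varying tail if $L(x)=P(W>x)$ is slowly varying at infinity, i.e. $P(W>x)>0$ for all $x$ and $P(W>cx)/P(W>x)\to1$ as $x\to\infty$ for every $c>0$. The notation $f(x)\sim g(x)$ means $f(x)/g(x)\to1$. *)

(* Defs.v *)
From HB Require Import structures.
From mathcomp Require Import all_boot all_order all_algebra.
From mathcomp Require Import all_classical all_reals all_analysis.

Set Implicit Arguments.
Unset Strict Implicit.
Unset Printing Implicit Defensive.

Import Order.TTheory GRing.Theory Num.Theory.
Import numFieldNormedType.Exports.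

Local Open Scope classical_set_scope.
Local Open Scope ring_scope.

Definition independent_RV2 (R : realType) (d d1 d2 : measure_display)
    (T : measurableType d) (T1 : measurableType d1) (T2 : measurableType d2)
    (P : probability T R) (X : {RV P >-> T1}) (Y : {RV P >-> T2}) : Prop :=
  forall (A : set T1) (B : set T2), measurable A -> measurable B ->
    P (X @^-1` A `&` Y @^-1` B) = (P (X @^-1` A) * P (Y @^-1` B))%E.

(* [ccdf W x] is P(W > x) in \bar R; it is always finite, so [fine] only
   changes its type. *)
Definition tail (R : realType) (d : measure_display) (T : measurableType d)
    (P : probability T R) (W : {RV P >-> R}) (x : R) : R :=
  fine (ccdf W x).

(* Stated as a limit of quotients rather than with MathComp-Analysis's [~_F],
   which is defined through little-o. *)
Definition asymp_equiv (R : realType) (f g : R -> R) : Prop :=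
  f x / g x @[x --> +oo] --> (1 : R).

Definition slowly_varying_tail (R : realType) (d : measure_display)
    (T : measurableType d) (P : probability T R) (W : {RV P >-> R}) : Prop :=
  (forall x : R, 0 < tail W x) /\
  (forall c : R, 0 < c -> asymp_equiv (fun x => tail W (c * x)) (tail W)).

(* Main.v *)
Require Import Defs.
From HB Require Import structures.
From mathcomp Require Import all_boot all_order all_algebra.
From mathcomp Require Import all_classical all_reals all_analysis.
From mathcomp Require Import measurable_realfun ring lra.

Set Implicit Arguments.
Unset Strict Implicit.
Unset Printing Implicit Defensive.

Import Order.TTheory GRing.Theory Num.Theory.
Import numFieldNormedType.Exports.

Local Open Scope classical_set_scope.
Local Open Scope ring_scope.

(** Write [L] and [G] for the tails of [X = Y Z] and [Z].  Both are compared at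
    points that differ by a constant factor, which slow variation of [L] makes
    harmless; so it suffices to bound each tail by the other up to a factor
    [1 - e], with the argument rescaled by a constant depending on [e] only
    ([asymp_equiv_sandwich]).

    One direction is immediate.  The variable [Y] exceeds some [2^-j] with
    probability at least [1 - e], and [Y > 2^-j], [Z > x] force
    [X > x / 2^j]; independence gives [(1 - e) G x <= L (x / 2^j)]
    ([factor_tail_le_dyadic]).

    For the other direction, if [x > 0] then almost surely [X > x] implies
    [Z > x / 2^m] unless [Y > 2^m], so that [L x <= G (x / 2^m) + P (Y > 2^m, X > x)], and the last term has to be
    small compared with [L x], uniformly in [x] ([joint_tail_le]).  Cut
    [Y > 2^m] into the dyadic shells [2^n < Y <= 2^(n+1)], on which [X > x]
    forces [Z > x / 2^(n+1)].  With [r = 2^(delta / 2)], three estimates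
    combine:
    - [P (Y > 2^n) <= A r^(-2n)], by the Markov inequality ([markov_dyadic]);
    - [G y <= 2 L (y / 2^j)] for a fixed [j], by the first direction;
    - [L (x / 2^k) <= C r^k L x] for all [k] and [x], a Potter bound
      ([dyadic_potter]).

    The shell [n] therefore contributes at most a constant times [r^-n L x], and
    these contributions form a convergent geometric series in [n].  The exponent
    [delta / 2] leaves the room needed: the moment gains [r^2] per shell, the
    Potter bound loses only [r].

    Once [G] is equivalent to [L], slow variation passes from [L] to [G]. *)

(** * Slowly varying functions *)

(** Beyond some [x0], slow variation gives [L (x / 2) <= r * L x], which can be
    iterated as long as the argument stays beyond [x0].  Below [x0] the constant
    [(L x0)^-1] absorbs everything, since [L <= 1] and [L] is nonincreasing. *)
Lemma dyadic_potter (R : realType) (L : R -> R) (r : R) :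
  (forall x, 0 < L x) -> (forall x, L x <= 1) -> {homo L : x y /~ x <= y} ->
  asymp_equiv (fun x => L (2^-1 * x)) L -> 1 < r ->
  exists C : R, 0 < C /\ forall k x, L (x / 2 ^+ k) <= C * r ^+ k * L x.
Proof.
move=> L0 L1 Ldec Lslow r1.
have r10 : 0 < r - 1 by rewrite subr_gt0.
have [x0 [_ x0P]] : \forall x \near +oo, `|1 - L (2^-1 * x) / L x| < r - 1.
  by move/cvgrPdist_lt : Lslow; apply.
have halve x : x0 < x -> L (x / 2) <= r * L x.
  move=> /x0P /=; rewrite ltr_distlC => /andP[_]; rewrite subrKC => /ltW.
  by rewrite ler_pdivrMr// mulrC.
have rk k : 1 <= r ^+ k by apply: exprn_ege1; exact: ltW.
exists (L x0)^-1; split; first by rewrite invr_gt0.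
have small k x : x <= x0 -> L (x / 2 ^+ k) <= (L x0)^-1 * r ^+ k * L x.
  move=> xx0; apply: (le_trans (L1 _)).
  rewrite mulrAC -[leLHS]mulr1; apply: ler_pM => //.
  by rewrite mulrC ler_pdivlMr// mul1r Ldec.
elim=> [x|k IH x].
  rewrite !expr0 divr1 mulr1 ler_peMl//; first exact: ltW.
  by rewrite invf_ge1.
have [/small //|x0x] := leP x x0.
have -> : x / 2 ^+ k.+1 = x / 2 / 2 ^+ k by rewrite exprS invfM mulrA.
apply: (le_trans (IH _)).
rewrite exprSr mulrA -[leRHS]mulrA ler_wpM2l// ?halve//.
by rewrite mulr_ge0 ?invr_ge0 ?(ltW (L0 _))// (le_trans ler01).
Qed.

(** The rescaling by [c] is allowed to depend on [e]: for each fixed [c] it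
    costs only a factor tending to 1. *)
Lemma asymp_equiv_sandwich (R : realType) (L G : R -> R) :
  (forall x, 0 < L x) ->
  (forall c, 0 < c -> asymp_equiv (fun x => L (c * x)) L) ->
  (forall e, 0 < e ->
     exists c, 0 < c /\ forall x, 0 < x -> (1 - e) * G x <= L (c * x)) ->
  (forall e, 0 < e ->
     exists c, 0 < c /\ forall x, 0 < x -> (1 - e) * L (c * x) <= G x) ->
  asymp_equiv G L.
Proof.
move=> L0 Lslow up lo; apply/cvgrPdist_lt => eps eps0.
(* With e <= 1/4, both (1 - e)^2 >= 1 - eps and (1 + e) / (1 - e) <= 1 + eps
   follow from 4e <= eps. *)
pose e := Num.min eps 1 / 4.
have e0 : 0 < e by rewrite divr_gt0// lt_min eps0 ltr01.
have e4 : e * 4 <= eps by rewrite /e divfK// ge_min lexx.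
have e1 : e * 4 <= 1 by rewrite /e divfK// ge_min lexx orbT.
have [c [c0 cP]] := up _ e0.
have [c' [c'0 c'P]] := lo _ e0.
have /cvgrPdist_lt/(_ _ e0) nc := Lslow _ c0.
have /cvgrPdist_lt/(_ _ e0) nc' := Lslow _ c'0.
near=> x.
have x0 : 0 < x by near: x; exact: nbhs_pinfty_gt.
have : `|1 - L (c * x) / L x| < e by near: x; exact: nc.
have : `|1 - L (c' * x) / L x| < e by near: x; exact: nc'.
rewrite !ltr_distlC => /andP[h1 _] /andP[_ h2].
have := cP _ x0; have := c'P _ x0.
rewrite -(@ler_pM2r _ (L x)^-1) ?invr_gt0// -mulrA => h3.
rewrite -(@ler_pM2r _ (L x)^-1) ?invr_gt0// -mulrA => h4.
apply/andP; split; nra.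
Unshelve. all: by end_near. Qed.

(** Formally [s m] is the sum over [n >= m] of its decrements
    [s n - s n.+1 <= d * rho ^+ n].  Subtracting the tail of the geometric series
    leaves a nondecreasing sequence with limit 0, hence a nonpositive one. *)
Lemma geometric_increment_bound (R : realType) (s : R^nat) (d rho : R) :
  s @ \oo --> (0 : R) -> 0 <= rho -> rho < 1 ->
  (forall m, s m <= s m.+1 + d * rho ^+ m) ->
  forall m, s m <= d / (1 - rho) * rho ^+ m.
Proof.
move=> s0 rho0 rho1 sS m.
have r1 : 0 < 1 - rho by rewrite subr_gt0.
pose t n := s n - d / (1 - rho) * rho ^+ n.
have t0 : t @ \oo --> (0 : R).
  rewrite -[0 in X in _ --> X](subr0 0) -[X in 0 - X](mulr0 (d / (1 - rho))).
  apply: cvgB => //; apply: cvgMr.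
  by apply: cvg_expr; rewrite ger0_norm.
have tnd : nondecreasing_seq t.
  apply/nondecreasing_seqP => n; rewrite /t.
  have -> : d / (1 - rho) * rho ^+ n.+1 =
      d / (1 - rho) * rho ^+ n - d * rho ^+ n.
    by rewrite exprS; field; rewrite gt_eqF.
  by have := sS n; lra.
have := nondecreasing_cvgn_le tnd (cvgP _ t0) m.
by rewrite (cvg_lim _ t0)// /t subr_le0.
Qed.

(** * Probabilities of events as real numbers *)

Section real_probability.
Context {R : realType} {d : measure_display} {T : measurableType d}.
Variable P : probability T R.

Lemma fine_probability_ge0 A : 0 <= fine (P A).
Proof. exact: fine_ge0. Qed.

Lemma le_fine_probability A B : measurable A -> measurable B ->
  A `<=` B -> fine (P A) <= fine (P B).
Proof.
move=> mA mB AB; apply: fine_le; rewrite ?fin_num_measure//.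
by apply: le_measure => //; rewrite inE.
Qed.

Lemma fine_probabilityU_le A B : measurable A -> measurable B ->
  fine (P (A `|` B)) <= fine (P A) + fine (P B).
Proof.
move=> mA mB; rewrite -fineD ?fin_num_measure//; apply: fine_le.
- by rewrite fin_num_measure//; exact: measurableU.
- by rewrite fin_numD !fin_num_measure.
- exact: measureU2.
Qed.

Lemma ccdfE (W : {RV P >-> R}) x : ccdf W x = P [set w | x < W w].
Proof.
rewrite /ccdf /= /pushforward; congr (P _).
by apply/seteqP; split => w /=; rewrite in_itv /= andbT.
Qed.

Lemma tailE (W : {RV P >-> R}) x : tail W x = fine (P [set w | x < W w]).
Proof. by rewrite /tail ccdfE. Qed.

Lemma measurable_gt (W : {RV P >-> R}) x : measurable [set w | x < W w].
Proof.
rewrite (_ : [set w | _] = W @^-1` `]x, +oo[); first exact: measurable_funPTI.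
by apply/seteqP; split => w /=; rewrite in_itv /= andbT.
Qed.

Lemma tail_ge0 (W : {RV P >-> R}) x : 0 <= tail W x.
Proof. by rewrite tailE; exact: fine_probability_ge0. Qed.

Lemma tail_le1 (W : {RV P >-> R}) x : tail W x <= 1.
Proof.
rewrite tailE -[leRHS]/(fine 1%:E); apply: fine_le => //.
  by rewrite fin_num_measure//; exact: measurable_gt.
by apply: probability_le1; exact: measurable_gt.
Qed.

Lemma tail_nonincreasing (W : {RV P >-> R}) : {homo tail W : x y /~ x <= y}.
Proof.
move=> x y xy; rewrite !tailE.
apply: le_fine_probability; try exact: measurable_gt.
by move=> w /=; exact: le_lt_trans.
Qed.

(** Right continuity of the tail at 0, where its value is 1. *)
Lemma tail_dyadic_near1 (Y : {RV P >-> R}) (e : R) :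
  {ae P, forall w, 0 < Y w} -> 0 < e ->
  exists j, 1 - e <= tail Y (2 ^- j).
Proof.
move=> Ypos e0.
have mY0 := measurable_gt Y 0.
have Y1 : ccdf Y 0 = 1%E.
  rewrite ccdfE -[X in P X]setCK.
  rewrite probability_setC; last exact: measurableC.
  by rewrite [X in (1 - X)%E]measure_negligible ?sube0//; exact: measurableC.
have : tail Y y @[y --> 0^'+] --> (1 : R).
  apply: fine_cvg; rewrite -Y1; exact: ccdf_right_continuous.
move=> /cvgrPdist_lt/(_ _ e0)[c /= c0 cP].
have : (fun n => 2^-1 ^+ n : R) @ \oo --> (0 : R).
  by apply: cvg_expr; rewrite ger0_norm ?invf_lt1// ltrDl.
move=> /cvgrPdist_lt/(_ _ c0)[j _ /(_ j (leqnn j)) /= jc].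
exists j; have := cP (2 ^- j).
rewrite /= -exprVn => /(_ jc); rewrite exprn_gt0 ?invr_gt0// => /(_ isT).
by rewrite ltr_distlC => /andP[/ltW].
Qed.

(** The square displays the bound as two powers of [r = 2 `^ (delta / 2)]: one
    compensates the growth of a Potter bound of ratio [r], the other makes a
    series over [m] converge. *)
Lemma markov_dyadic (Y : {RV P >-> R}) (delta : R) :
  0 < delta -> ('E_P[fun w => (Y w `^ delta)%R] < +oo)%E ->
  exists A : R, 0 <= A /\
    forall m, tail Y (2 ^+ m) <= A / ((2 `^ (delta / 2)) ^+ m) ^+ 2.
Proof.
move=> d0; rewrite unlock; set E := (\int[P]_w _)%E => Efin.
have E0 : (0 <= E)%E by apply: integral_ge0 => w _; rewrite lee_fin powR_ge0.
have Enum : E \is a fin_num by rewrite ge0_fin_numE.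
exists (fine E); split; first exact: fine_ge0.
move=> m.
have mYd : measurable_fun setT (fun w => Y w `^ delta).
  by apply: (measurableT_comp (f := fun y => y `^ delta)) => //.
have powE : (2 ^+ m : R) `^ delta = ((2 `^ (delta / 2)) ^+ m) ^+ 2.
  rewrite -!powR_mulrn ?powR_ge0// -!powRrM; congr (_ `^ _).
  by field.
have a0 : 0 < ((2 : R) `^ (delta / 2)) ^+ m ^+ 2.
  by rewrite !exprn_gt0// powR_gt0.
rewrite ler_pdivlMr//.
have := @le_integral_comp_abse _ _ _ P setT measurableT
  (fun w => (Y w `^ delta)%:E) _ id (@measurable_id _ _ _)
  (fun _ h => h) (fun _ _ _ _ h => h) (proj2 (measurable_EFinP _ _) mYd) a0.
have -> : (\int[P]_w `|(Y w `^ delta)%:E| = E)%E.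
  by apply: eq_integral => w _; rewrite gee0_abs// lee_fin powR_ge0.
rewrite setTI => markovE.
rewrite -lee_fin fineK// mulrC EFinM; apply: le_trans markovE.
apply: lee_wpmul2l; first by rewrite lee_fin ltW.
rewrite tailE fineK; last by rewrite fin_num_measure//; exact: measurable_gt.
apply: le_measure; rewrite ?inE.
- exact: measurable_gt.
- rewrite -[X in measurable X]setTI; apply: emeasurable_fun_c_infty => //.
  by apply: measurableT_comp => //; exact/measurable_EFinP.
move=> w /= Yw; rewrite lee_fin ger0_norm ?powR_ge0// -powE.
apply: ge0_ler_powR; rewrite ?nnegrE ?(ltW d0) ?exprn_ge0//; last exact: ltW.
by apply: ltW; apply: le_lt_trans Yw; rewrite exprn_ge0.
Qed.

End real_probability.

(** * Tails of a product of independent variables *)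

Section product_tail.
Context {R : realType} {d : measure_display} {T : measurableType d}.
Variables (P : probability T R) (X Y Z : {RV P >-> R}).
Hypothesis Y_pos : {ae P, forall w, 0 < Y w}.
Hypothesis YZ_indep : independent_RV2 Y Z.
Hypothesis X_eq : forall w, X w = Y w * Z w.

Lemma independent_tails y z :
  fine (P [set w | y < Y w /\ z < Z w]) = tail Y y * tail Z z.
Proof.
rewrite /tail -fineM ?fin_num_measure//.
rewrite /ccdf /= /pushforward -YZ_indep//; congr (fine (P _)).
by apply/seteqP; split => w /=; rewrite !in_itv/= !andbT.
Qed.

Lemma tail_product_ge y x : 0 < y -> 0 < x ->
  tail Y y * tail Z x <= tail X (y * x).
Proof.
move=> y0 x0; rewrite -independent_tails tailE.
apply: le_fine_probability; last first.
- by move=> w /= [yY xZ]; rewrite X_eq ltr_pM// ltW.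
- exact: measurable_gt.
- by apply: measurableI; exact: measurable_gt.
Qed.

Let joint_tail m x := fine (P [set w | 2 ^+ m < Y w /\ x < X w]).

Let measurable_joint m x : measurable [set w | 2 ^+ m < Y w /\ x < X w].
Proof. by apply: measurableI; exact: measurable_gt. Qed.

(** Almost sure positivity of [Y] enters here: where [Y] is negative,
    [X > x] would bound [Z] from above. *)
Lemma tail_product_le_dyadic m x : 0 < x ->
  tail X x <= joint_tail m x + tail Z (x / 2 ^+ m).
Proof.
move=> x0; have mY0 := measurable_gt Y 0.
have nY0 : P (~` [set w | 0 < Y w]) = 0%E.
  by apply: measure_negligible => //; exact: measurableC.
rewrite !tailE -[leRHS]add0r -[0]/(fine 0%E) -nY0.
have mZ : measurable [set w | x / 2 ^+ m < Z w] := measurable_gt Z _.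
have mSZ := measurableU _ _ (measurable_joint m x) mZ.
apply: le_trans
  (lerD (lexx _) (fine_probabilityU_le P (measurable_joint m x) mZ)).
apply: le_trans (fine_probabilityU_le P (measurableC mY0) mSZ).
apply: le_fine_probability; first exact: measurable_gt.
  by apply: measurableU => //; exact: measurableC.
move=> w /= xX; have [Y0|] := boolP (0 < Y w); last by left.
right; have [mY|Ym] := ltP (2 ^+ m) (Y w); [by left|right].
have Z0 : 0 < Z w.
  by rewrite -(pmulr_rgt0 _ Y0) -X_eq (lt_trans x0).
rewrite ltr_pdivrMr ?exprn_gt0// mulrC (lt_le_trans xX)// X_eq.
by rewrite ler_pM2r.
Qed.

(** Peels off the shell [2 ^+ m < Y <= 2 ^+ m.+1], on which [X > x] forces
    [Z > x / 2 ^+ m.+1].  The shell is enlarged to [2 ^+ m < Y] before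
    independence is applied, so that only tails of [Y] occur. *)
Lemma joint_tail_dyadic_step m x : 0 < x ->
  joint_tail m x <=
    joint_tail m.+1 x + tail Y (2 ^+ m) * tail Z (x / 2 ^+ m.+1).
Proof.
move=> x0; rewrite -independent_tails.
have mYZ : measurable [set w | 2 ^+ m < Y w /\ x / 2 ^+ m.+1 < Z w].
  by apply: measurableI; exact: measurable_gt.
apply: le_trans (fine_probabilityU_le P (measurable_joint m.+1 x) mYZ).
apply: le_fine_probability => //; first exact: measurableU.
move=> w /= [mY xX]; have [mY'|Ym] := ltP (2 ^+ m.+1) (Y w); [by left|right].
split=> //.
have Y0 : 0 < Y w by apply: le_lt_trans mY; rewrite exprn_ge0.
have Z0 : 0 < Z w.
  by rewrite -(pmulr_rgt0 _ Y0) -X_eq (lt_trans x0).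
rewrite ltr_pdivrMr ?exprn_gt0// mulrC (lt_le_trans xX)// X_eq.
by rewrite ler_pM2r.
Qed.

Lemma factor_tail_le_dyadic e : 0 < e ->
  exists j, forall x, 0 < x -> (1 - e) * tail Z x <= tail X (x / 2 ^+ j).
Proof.
move=> e0; have [j jP] := tail_dyadic_near1 Y_pos e0; exists j => x x0.
rewrite (mulrC x); apply: le_trans (tail_product_ge _ x0) => //.
  by rewrite ler_wpM2r// tail_ge0.
Qed.

Hypothesis X_slow : slowly_varying_tail X.
Hypothesis Y_moment : exists delta : R,
  0 < delta /\ ('E_P[fun w => (Y w `^ delta)%R] < +oo)%E.

(** Large values of [Y] contribute a negligible part of the tail of [X],
    uniformly in the level [x]. *)
Lemma joint_tail_le : exists B r : R, [/\ 0 <= B, 1 < r &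
  forall m x, 0 < x -> joint_tail m x <= B * tail X x * r^-1 ^+ m].
Proof.
have [delta [d0 EY]] := Y_moment.
have [A [A0 YA]] := markov_dyadic d0 EY.
pose r : R := 2 `^ (delta / 2).
have r1 : 1 < r.
  by rewrite /r /powR gt_eqF// expR_gt1 mulr_gt0 ?divr_gt0// ln_gt0// ltr1n.
have r0 : 0 < r := lt_trans ltr01 r1.
have [Xpos Xsv] := X_slow.
have half0 : 0 < 2^-1 :> R by rewrite invr_gt0.
have [C [C0 CP]] := dyadic_potter Xpos (@tail_le1 _ _ _ P X)
  (@tail_nonincreasing _ _ _ P X) (Xsv _ half0) r1.
have [j jP] := factor_tail_le_dyadic half0.
have Zle m x : 0 < x ->
    tail Z (x / 2 ^+ m.+1) <= 2 * C * r ^+ j * r ^+ m.+1 * tail X x.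
  move=> x0; have := jP (x / 2 ^+ m.+1).
  rewrite divr_gt0 ?exprn_gt0// => /(_ isT).
  rewrite -mulrA -invfM -exprD => /le_trans/(_ (CP _ _)).
  rewrite exprD; lra.
pose D := A * (2 * C * r ^+ j * r).
have D0 : 0 <= D by rewrite !mulr_ge0 ?exprn_ge0 ?(ltW C0) ?(ltW r0).
have ir0 : 0 <= r^-1 by rewrite invr_ge0 ltW.
have ir1 : r^-1 < 1 by rewrite invf_lt1.
have ir10 : 0 < 1 - r^-1 by rewrite subr_gt0.
exists (D / (1 - r^-1)), r; split=> //; first by rewrite divr_ge0// ltW.
move=> m x x0.
rewrite [D / _ * _]mulrAC; move: m.
apply: (@geometric_increment_bound _ (joint_tail ^~ x)) => //.
(* The joint tail is at most P(Y > 2^n), which tends to 0. *)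
- apply: (@squeeze_cvgr _ _ _ _ (fun=> 0) (fun n => A * (r^-1 ^+ n))).
  + apply: nearW => n; rewrite fine_probability_ge0 /=.
    apply: (le_trans (y := tail Y (2 ^+ n))).
      rewrite tailE; apply: le_fine_probability => //.
        exact: measurable_gt.
      by move=> w [].
    apply: (le_trans (YA n)); rewrite ler_wpM2l// -exprM -exprVn -/r.
    by rewrite ler_wiXn2l// ?(ltW ir1)// muln2 -addnn leq_addr.
  + exact: cvg_cst.
  + rewrite -[X in _ --> X](mulr0 A); apply: cvgMr; apply: cvg_expr.
    by rewrite ger0_norm.
- move=> n; apply: (le_trans (joint_tail_dyadic_step n x0)).
  rewrite lerD2l.
  apply: (le_trans (ler_pM (tail_ge0 _ _) (tail_ge0 _ _) (YA n) (Zle n x x0))).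
  rewrite -/r le_eqVlt; apply/orP; left; apply/eqP.
  rewrite /D exprVn [r ^+ n.+1]exprS; field.
  by rewrite expf_neq0 ?gt_eqF.
Qed.

Lemma factor_tail_ge_dyadic e : 0 < e ->
  exists m, forall x, 0 < x -> (1 - e) * tail X (2 ^+ m * x) <= tail Z x.
Proof.
move=> e0; have [B [r [B0 r1 BP]]] := joint_tail_le.
have : (fun n => B * r^-1 ^+ n) @ \oo --> (0 : R).
  rewrite -[X in _ --> X](mulr0 B); apply: cvgMr; apply: cvg_expr.
  by rewrite ger0_norm ?invf_lt1// ?invr_ge0 ?ltW// (lt_trans ltr01).
move=> /cvgrPdist_lt/(_ _ e0)[m _ /(_ m (leqnn m)) /= mB].
exists m => x x0.
have x20 : 0 < 2 ^+ m * x by rewrite mulr_gt0 ?exprn_gt0.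
have := tail_product_le_dyadic m x20.
rewrite mulrAC divff ?mul1r ?gt_eqF ?exprn_gt0// => /le_trans.
move=> /(_ _ (lerD (BP m _ x20) (lexx _))).
have := tail_ge0 X (2 ^+ m * x).
move: mB; rewrite sub0r normrN => /(le_lt_trans (ler_norm _)).
nra.
Qed.

End product_tail.

(** * Slow variation passes from the product to the factor *)

Theorem proposition4p11 (R : realType) (d : measure_display)
    (T : measurableType d) (P : probability T R) (X Y Z : {RV P >-> R})
    (Y_pos : {ae P, forall w, 0 < Y w})
    (YZ_indep : independent_RV2 Y Z)
    (X_eq : forall w, X w = Y w * Z w)
    (X_slow : slowly_varying_tail X)
    (Y_moment : exists delta : R,
       0 < delta /\ ('E_P[fun w => (Y w `^ delta)%R] < +oo)%E) :
  slowly_varying_tail Z /\ asymp_equiv (tail Z) (tail X).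
Proof.
have [Xpos Xsv] := X_slow.
have Zlo := factor_tail_ge_dyadic Y_pos YZ_indep X_eq X_slow Y_moment.
have ZX : asymp_equiv (tail Z) (tail X).
  apply: asymp_equiv_sandwich => // e e0.
    have [j jP] := factor_tail_le_dyadic Y_pos YZ_indep X_eq e0.
    exists (2 ^- j); rewrite invr_gt0 exprn_gt0//; split=> // x /jP.
    by rewrite [2 ^- j * x]mulrC.
  have [m mP] := Zlo _ e0.
  by exists (2 ^+ m); rewrite exprn_gt0.
(* The comparison covers positive arguments only; monotonicity does the rest. *)
have Zpos x : 0 < tail Z x.
  have half0 : 0 < 2^-1 :> R by rewrite invr_gt0.
  have [m /(_ (Num.max 1 x)) mP] := Zlo _ half0.
  apply: (lt_le_trans (y := tail Z (Num.max 1 x))); last first.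
    by apply: tail_nonincreasing; rewrite le_max lexx orbT.
  apply: lt_le_trans (mP _); last by rewrite lt_max ltr01.
  by rewrite mulr_gt0// subr_gt0 invf_lt1// ltr1n.
split=> //; split=> // c c0.
have ZXc : tail Z (c * x) / tail X (c * x) @[x --> +oo] --> (1 : R).
  have cxy : c * x @[x --> +oo] --> +oo.
    by apply: gt0_cvgMry => //; exact: cvg_id.
  exact: (cvg_comp (fun x => c * x) (fun x => tail Z x / tail X x) cxy ZX).
have XZ : (tail Z x / tail X x)^-1 @[x --> +oo] --> (1 : R).
  by rewrite -[X in _ --> X]invr1; apply: cvgV => //; exact: oner_neq0.
have : tail Z (c * x) / tail X (c * x) * (tail X (c * x) / tail X x) *
    (tail Z x / tail X x)^-1 @[x --> +oo] --> (1 * 1 * 1 : R).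
  by apply: cvgM => //; apply: cvgM => //; exact: Xsv.
rewrite !mulr1; apply: cvg_trans; apply: near_eq_cvg; apply: nearW => x /=.
by field; rewrite !gt_eqF.
Qed.
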